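(* For every positive integer $n$, the map $\Phi$ defined below is a bijection $\Phi:\mathcal O(n)\to\mathcal D(n)$ which extends Bressoud's map $B$ (i.e. $\Phi(\lambda)=B(\lambda)$ for $\lambda\in\mathcal O(n)\cap\mathcal D(n)$), and for every $\lambda\in\mathcal O(n)$, $$|\Phi(\lambda)|_a=\ell(\lambda)\qquad\text{and}\qquad \ell_o(\Phi(\lambda))=n_o(\lambda).$$
   Context: A partition $\lambda$ of $n$ is a non-increasing sequence $\lambda=(\lambda_1,\dots,\lambda_\ell)$ of positive integers with sum $n$; $\ell(\lambda)=\ell$ is its length, and by convention $\lambda_j=0$ for $j>\ell$. $\mathcal O(n)$ is the set of partitions of $n$ all of whose parts are odd; $\mathcal D(n)$ is the set of partitions of $n$ with distinct parts. The alternating sum is $|\lambda|_a=\sum_{j=1}^{\ell}(-1)^{j-1}\lambda_j$; $\ell_o(\lambda)$ is the number of odd parts of $\lambda$; $m_i(\lambda)$ is the multiplicity of $i$ as a part of $\lambda$; $n_o(\lambda)$ is the number of $i>0$ with $m_i(\lambda)$ odd. For partitions $\alpha,\beta$, $\alpha\circ\beta$ is the partition whose parts are all parts of $\alpha$ and of $\beta$ (with multiplicity) in non-increasing order, and $\alpha^2=\alpha\circ\alpha$. Bressoud's map $B$ on $\mathcal O(n)\cap\mathcal D(n)$: let $\beta\in\mathcal O(n)\cap\mathcal D(n)$. Decompose the parts of $\beta$ into its runs (maximal sequences of consecutive odd integers all occurring as parts of $\beta$). For a run $2m-1>2m-3>\dots>2m-2k+1$, form pairs $(2m-1,2m-3),(2m-5,2m-7),\dots$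 starting from the largest term; if $k$ is odd, the remaining smallest term $c=2m-2k+1$ is replaced by the pair $(\frac{c+1}{2},\frac{c-1}{2})$. Let $\pi=(\pi_1,\dots,\pi_{2s})$ be the concatenation of all these pairs, runs in decreasing order and pairs within a run in the order formed; the pairs of $\pi$ are $(\pi_{2j-1},\pi_{2j})$. A pair interchange: if $(\pi_{2j-1},\pi_{2j})=(a+1,a)$ and $(\pi_{2j+1},\pi_{2j+2})=(2b+1,2b-1)$ with $a\le 2b+1$, replace these four entries by $(2b+3,2b+1,a-1,a-2)$. Starting from $\pi$, repeatedly perform pair interchanges (each time the leftmost available one) until none is possible, then delete zero entries; the result is $B(\beta)$ (for $\beta$ empty, $B(\beta)$ is empty). Insertion: for a partition $\gamma$ (with $\gamma_k=0$ for $k>\ell(\gamma)$) and an integer $a\ge1$, define $I_a(\gamma)$ (the insertion of the pair $(2a-1)^2$) as follows. For $j=0,1,2,\dots$ in turn: if $j=a-1$, set $I_a(\gamma)=(\gamma_1+2,\dots,\gamma_{2j}+2,\gamma_{2j+1}+2,\gamma_{2j+2},\gamma_{2j+3},\dots)$ and stop; otherwise, if $2a-2j-2>\gamma_{2j+1}$, set $I_a(\gamma)=(\gamma_1+2,\dots,\gamma_{2j}+2,\,2a-2j,\,2a-2j-2,\,\gamma_{2j+1},\gamma_{2j+2},\dots)$ and stop; otherwise pass to $j+1$. Zero entries are discarded. The map $\Phi$: for $\lambda\in\mathcal O(n)$ write uniquely $\lambda=\alpha^2\circ\beta$ with $\beta$ having distinct parts (so $\beta$ consists of the parts $i$ with $m_i(\lambda)$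 odd, each once, and $\alpha$ contains each $i$ with multiplicity $\lfloor m_i(\lambda)/2\rfloor$). Let $t=\ell(\alpha)$ and $\alpha_i=2a_i-1$ for $i=1,\dots,t$ (with $\alpha_1\ge\dots\ge\alpha_t$). Set $\gamma^{(0)}=B(\beta)$ and $\gamma^{(i)}=I_{a_i}(\gamma^{(i-1)})$ for $i=1,\dots,t$, and define $\Phi(\lambda)=\gamma^{(t)}$. *)

(* Defs.v *)
From mathcomp Require Import all_boot all_order all_algebra.
Set Implicit Arguments. Unset Strict Implicit. Unset Printing Implicit Defensive.
Import GRing.Theory.

Definition is_partition (s : seq nat) : bool :=
  sorted (fun a b => b <= a) s && all (fun x => 0 < x) s.

Definition in_O (n : nat) (s : seq nat) : bool :=
  [&& is_partition s, sumn s == n & all odd s].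

Definition in_D (n : nat) (s : seq nat) : bool :=
  [&& is_partition s, sumn s == n & uniq s].

Definition alt_sum (s : seq nat) : int :=
  \sum_(j < size s) (-1) ^+ j * (nth 0 s j)%:Z.

Definition ell_o (s : seq nat) : nat := count odd s.

Definition mult (s : seq nat) (i : nat) : nat := count_mem i s.

Definition n_o (s : seq nat) : nat :=
  count (fun i => (0 < i) && odd (mult s i)) (undup s).

Fixpoint split_runs (s : seq nat) : seq (seq nat) :=
  match s with
  | [::] => [::]
  | x :: s' =>
      match split_runs s' with
      | [::] => [:: [:: x]]
      | r :: rs => if head 0 r + 2 == x then (x :: r) :: rs
                   else [:: x] :: r :: rs
      end
  end.

(* pair a run from its largest term; a leftover smallest term c becomes
   the pair ((c+1)/2, (c-1)/2) *)
Fixpoint pair_run (r : seq nat) : seq nat :=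
  match r with
  | [::] => [::]
  | [:: c] => [:: c.+1./2; c./2]
  | x :: y :: r' => x :: y :: pair_run r'
  end.

Definition bressoud_pairs (beta : seq nat) : seq nat :=
  flatten (map pair_run (split_runs beta)).

(* the leftmost available pair interchange (pairs are at positions
   (2j-1,2j)): (a+1,a),(2b+1,2b-1) with a <= 2b+1, b >= 1, becomes
   (2b+3,2b+1,a-1,a-2) *)
Fixpoint interchange_step (p : seq nat) : option (seq nat) :=
  match p with
  | x1 :: x2 :: tl =>
      match tl with
      | y1 :: y2 :: rest =>
          if [&& x1 == x2.+1, odd y1, y1 == y2 + 2, 0 < y2 & x2 <= y1]
          then Some (y1.+2 :: y1 :: x2.-1 :: x2 - 2 :: rest)
          else omap (fun t => x1 :: x2 :: t) (interchange_step tl)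
      | _ => None
      end
  | _ => None
  end.

Fixpoint interchange_iter (fuel : nat) (p : seq nat) : seq nat :=
  match fuel with
  | 0 => p
  | k.+1 => match interchange_step p with
            | Some q => interchange_iter k q
            | None => p
            end
  end.

(* Each interchange strictly decreases sum_i i*pi_i (by 4a-8b-6 <= -2),
   a quantity bounded by size * sum, so this fuel suffices to reach the
   state where no interchange is possible. *)
Definition B (beta : seq nat) : seq nat :=
  let pi := bressoud_pairs beta in
  [seq x <- interchange_iter ((size pi).+1 * (sumn pi).+1) pi | 0 < x].

(* ins t g performs the insertion of (2a-1)^2 with t = a-1-j at stage j,
   on the (zero-padded) remainder g = (gamma_{2j+1}, gamma_{2j+2}, ...) *)
Fixpoint ins (t : nat) (g : seq nat) : seq nat :=
  match t with
  | 0 => (head 0 g).+2 :: behead g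
  | t'.+1 =>
      if head 0 g < t.*2 then t.+1.*2 :: t.*2 :: g
      else (nth 0 g 0).+2 :: (nth 0 g 1).+2 :: ins t' (drop 2 g)
  end.

Definition I (a : nat) (g : seq nat) : seq nat :=
  [seq x <- ins a.-1 g | 0 < x].

Definition beta_part (l : seq nat) : seq nat :=
  sort (fun a b => b <= a) [seq i <- undup l | odd (mult l i)].

Definition alpha_part (l : seq nat) : seq nat :=
  sort (fun a b => b <= a)
       (flatten [seq nseq (mult l i)./2 i | i <- undup l]).

(* alpha_i = 2 a_i - 1, i.e. a_i = (alpha_i + 1)/2; insert in order
   alpha_1 >= ... >= alpha_t *)
Definition Phi (l : seq nat) : seq nat :=
  foldl (fun g x => I x.+1./2 g) (B (beta_part l)) (alpha_part l).

(* Main.v *)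
Require Import Defs.
From mathcomp Require Import all_boot all_order all_algebra.
From mathcomp Require Import zify.
Set Implicit Arguments. Unset Strict Implicit. Unset Printing Implicit Defensive.
Import GRing.Theory.

(* Read a partition as a list of consecutive pairs (zero-padded), and attach to
   a pair with sum w, followed by i further pairs, the shifted weight
   v = w - 4 i.  When the two entries differ by 1 or 2 the pair is determined by
   w.  In shifted weights a pair interchange is a mere transposition of two
   adjacent entries v < v' (v odd, 4 | v'), so B sorts; and inserting (2a-1)^2
   into k pairs either inserts the new weight 4(a-1-k)+2 into the sorted list
   (if a > k), or adds two columns of height 2a-1 to the diagram (if a <= k).
   As the a_i decrease and k grows, all the insertions of the first kind come
   first.  Conversely a partition into distinct parts determines its column
   pairs (reduce each difference within a pair to 1 or 2) and then the sorted
   weights; those congruent to 2 mod 4 come from the insertions, and the others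
   determine beta. *)

(** * Pair interchanges as sorting of shifted weights *)

Fixpoint unshift (u : seq nat) : seq nat :=
  if u is v :: u' then
    (v + 4 * size u')./2.+1 :: (v + 4 * size u').-1./2 :: unshift u'
  else [::].

(* The order in which the shifted weights of strictly decreasing pairs appear:
   only odd weights may be repeated. *)
Definition wge (x y : nat) : bool := (y < x) || odd x && (x == y).

Fixpoint swap_step (u : seq nat) : option (seq nat) :=
  match u with
  | v1 :: ((v2 :: r) as tl) =>
      if [&& odd v1, 4 %| v2 & v1 < v2] then Some (v2 :: v1 :: r)
      else omap (cons v1) (swap_step tl)
  | _ => None
  end.

Lemma swap_step_cons2 v1 v2 r : swap_step (v1 :: v2 :: r) =
  if [&& odd v1, 4 %| v2 & v1 < v2] then Some (v2 :: v1 :: r)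
  else omap (cons v1) (swap_step (v2 :: r)).
Proof. by []. Qed.

Lemma swap_step_perm u u' : swap_step u = Some u' -> perm_eq u' u.
Proof.
elim: u u' => [//|v1 [//|v2 r] IH] u'; rewrite swap_step_cons2.
case: ifP => _.
  by case=> <-; apply/permP=> p /=; rewrite addnCA.
case E: (swap_step (v2 :: r)) => [s|] //=.
by case=> <-; rewrite perm_cons; apply: IH.
Qed.

(** An interchange takes 4 from the sum of the pair that moves right and adds 4 to the other, which
    is what the shift prescribes when two weights trade places. The bound [x2 <= y1] turns into
    [v1 < v2], and two odd entries with difference 2 mean [4 %| v2]. *)
Lemma interchange_step_unshift u : all (leq 1) u ->
  interchange_step (unshift u) = omap unshift (swap_step u).
Proof.
elim: u => [//|v1 [//|v2 r] IH] /and3P[v1p v2p rp].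
have {}IH := IH (introT andP (conj v2p rp)).
rewrite [LHS]/= swap_step_cons2.
set c := [&& _, _, _, _ & _]; set c' := [&& _, _ & _].
have -> : c = c' by rewrite /c /c'; lia.
rewrite {}/c; case: ifP => cP.
  by rewrite /=; congr (Some [:: _, _, _, _ & _]); move: cP; rewrite /c'; lia.
move: IH; rewrite [in LHS]/= => ->.
case E: (swap_step (v2 :: r)) => [s|] //=.
by rewrite (perm_size (swap_step_perm E)).
Qed.

(** Only parities are compared: a swap brings one even entry before one odd entry and keeps all
    other relative orders, so this measure drops by exactly one. *)
Fixpoint inversions (u : seq nat) : nat :=
  if u is v :: u' then odd v * count (fun y => ~~ odd y) u' + inversions u'
  else 0.

Lemma inversions_le u : inversions u <= size u * size u.
Proof.
elim: u => [//|v u IH] /=.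
have := count_size (fun y => ~~ odd y) u; case: (odd v); lia.
Qed.

Lemma inversions_step u u' :
  swap_step u = Some u' -> inversions u = (inversions u').+1.
Proof.
elim: u u' => [//|v1 [//|v2 r] IH] u'; rewrite swap_step_cons2.
case: ifP => c.
  case=> <- /=.
  have -> : odd v1 by lia.
  have -> : odd v2 = false by lia.
  by lia.
case E: (swap_step (v2 :: r)) => [s|] //=.
case=> <-; have /= -> := IH _ E.
have /permP /(_ (fun y => ~~ odd y)) /= -> := swap_step_perm E.
by rewrite addnS.
Qed.

(* Invariant of the interchanges: two entries are out of order only when an odd
   weight precedes an even one. *)
Definition presorted (x y : nat) : bool := odd x && ~~ odd y || wge x y.

(** The swapped entries end up strictly decreasing, and no other relative order changes. *)
Lemma presorted_step u u' :
  swap_step u = Some u' -> pairwise presorted u -> pairwise presorted u'.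
Proof.
elim: u u' => [//|v1 [//|v2 r] IH] u'; rewrite swap_step_cons2.
case: ifP => c.
  case=> <- /= /and3P[/andP[_ ->] -> ->]; rewrite andbT /presorted /wge.
  by lia.
case E: (swap_step (v2 :: r)) => [s|] //=.
case=> <- /andP[a1 p]; rewrite /= (IH _ E) // andbT.
by rewrite (perm_all _ (swap_step_perm E)).
Qed.

Definition bressoud_weight (v : nat) : bool := (0 < v) && (odd v || (4 %| v)).

(** Even entries are multiples of 4 here, so an odd entry followed by a larger even one would still
    allow a swap. *)
Lemma swap_step_None u : all bressoud_weight u -> pairwise presorted u ->
  swap_step u = None -> sorted wge u.
Proof.
elim: u => [//|v1 [//|v2 r] IH].
move=> /andP[g1 g] /andP[a1 p]; rewrite swap_step_cons2.
case: ifP => // c; case E: (swap_step (v2 :: r)) => [//|] _.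
have := IH g p E; rewrite /= => ->; rewrite andbT.
move: a1 g1 g c => /= /andP[+ _] + /andP[+ _].
by rewrite /presorted /bressoud_weight /wge; lia.
Qed.

(** Each step uses up one inversion, so this fuel leads to a list without swaps, which is sorted by
    [swap_step_None]. *)
Lemma interchange_iterE k u : all bressoud_weight u -> pairwise presorted u ->
  inversions u <= k ->
  exists u', [/\ interchange_iter k (unshift u) = unshift u',
                 perm_eq u' u & sorted wge u'].
Proof.
elim: k u => [|k IH] u g p le_k /=.
  exists u; split=> //; apply: swap_step_None => //.
  by case E: (swap_step u) => [s|//]; have := inversions_step E; lia.
rewrite interchange_step_unshift; last first.
  by apply: sub_all g => x /andP[].
case E: (swap_step u) => [s|] /=; last first.
  by exists u; split=> //; apply: swap_step_None.
have pE := swap_step_perm E.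
have [|||u' [e1 e2 e3]] := IH s.
- by rewrite (perm_all _ pE).
- exact: presorted_step E p.
- by have := inversions_step E; lia.
by exists u'; split=> //; apply: perm_trans pE.
Qed.

(** * Tokens: partitions into distinct odd parts and their weights *)

(* A partition into distinct odd parts is a list of tokens (b, m): a pair of
   consecutive odd numbers if b, a single part otherwise.  The largest part of
   a token followed by i tokens is m + 4 i + 1, so that the m are even and
   non-increasing. *)
Fixpoint token_weights (t : seq (bool * nat)) : seq nat :=
  if t is (b, m) :: t' then
    (if b then 2 * m + 4 * size t' else m.+1) :: token_weights t'
  else [::].

Fixpoint token_parts (t : seq (bool * nat)) : seq nat :=
  if t is (b, m) :: t' then
    let f := m + 4 * size t' in
    if b then f.+1 :: f.-1 :: token_parts t' else f.+1 :: token_parts t'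
  else [::].

(** Non-increasing [m] means that the largest parts of successive tokens drop by at least 4, so a
    single part always ends its run, as in Bressoud's pairing. The condition [0 < m + size t']
    excludes the pair of parts 1 and 0. *)
Fixpoint valid_tokens (t : seq (bool * nat)) : bool :=
  if t is (b, m) :: t' then
    [&& ~~ odd m, b ==> (0 < m + size t'), all (fun x => x.2 <= m) t'
      & valid_tokens t']
  else true.

Lemma size_token_weights t : size (token_weights t) = size t.
Proof. by elim: t => [|[b m] t IH] //=; rewrite IH. Qed.

(** Pairing starts at the top of a run, so it does not matter whether [x] extends the first run of
    [s]. *)
Lemma bressoud_pairs_pair x s : 
  bressoud_pairs (x.+2 :: x :: s) = x.+2 :: x :: bressoud_pairs s.
Proof.
rewrite /bressoud_pairs /=.
case: (split_runs s) => [|r rs] /=; first by rewrite addn2 eqxx.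
by case: ifP => _ /=; rewrite addn2 eqxx.
Qed.

Lemma bressoud_pairs_single x s : (if s is y :: _ then y + 2 != x else true) ->
  bressoud_pairs (x :: s) = x.+1./2 :: x./2 :: bressoud_pairs s.
Proof.
rewrite /bressoud_pairs; case: s => [//|y s] /= yx.
case: (split_runs s) => [|r rs] /=; first by rewrite (negPf yx).
by case: ifP => _ /=; rewrite (negPf yx).
Qed.

Lemma token_parts_head t : token_parts t =
  if t is (b, m) :: t' then (m + 4 * size t').+1 :: behead (token_parts t)
  else [::].
Proof. by case: t => [|[[] m] t']. Qed.

Lemma bressoud_pairs_tokens t : valid_tokens t ->
  bressoud_pairs (token_parts t) = unshift (token_weights t).
Proof.
elim: t => [//|[b m] t IH] /= /and4P[ev pos bd ok].
rewrite size_token_weights -(IH ok).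
case: b pos => /= pos.
  (* Positivity gives the two parts the shape [x.+2], [x]. *)
  have [x xE] : exists x, x.+1 = m + 4 * size t by exists (m + 4 * size t).-1; lia.
  by rewrite -xE /= bressoud_pairs_pair; congr [:: _, _ & _]; lia.
rewrite bressoud_pairs_single; first by congr [:: _, _ & _]; lia.
rewrite token_parts_head; case: t bd {ok IH pos} => [//|[b' m'] t] /= /andP[].
by lia.
Qed.

(** A pair has at most [size t - 1] tokens behind it, whence the 4 on the left; a single part has
    weight [m + 1] wherever it stands. *)
Lemma token_weights_bound t M : valid_tokens t -> all (fun x => x.2 <= M) t ->
  all (fun y => if odd y then y <= M.+1 else y + 4 <= 2 * M + 4 * size t)
      (token_weights t).
Proof.
elim: t => [//|[b m] t IH] /= /and4P[ev pos bd ok] /andP[le_m le_t].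
apply/andP; split; first by case: b {pos} => /=; case: ifP; lia.
apply: sub_all (IH ok le_t) => y /=; case: ifP; lia.
Qed.

Lemma bressoud_weight_tokens t : valid_tokens t -> all bressoud_weight (token_weights t).
Proof.
elim: t => [//|[b m] t IH] /= /and4P[ev pos bd ok].
by rewrite (IH ok) andbT /bressoud_weight; case: b pos => /=; lia.
Qed.

(** A pair outweighs everything after it, and a single part weakly outweighs later single parts; a
    single part before a pair is the tolerated disorder. *)
Lemma presorted_tokens t : valid_tokens t -> pairwise presorted (token_weights t).
Proof.
elim: t => [//|[b m] t IH] /= /and4P[ev pos bd ok].
rewrite (IH ok) andbT.
apply: sub_all (token_weights_bound ok bd) => y; rewrite /presorted /wge.
case: t bd ok {IH} pos => [|t0 t] bd ok pos; case: b pos => /=; case: ifP; lia.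
Qed.

Lemma wge_trans : transitive wge.
Proof. by move=> y x z; rewrite /wge; lia. Qed.

Lemma wge_anti : antisymmetric wge.
Proof. by move=> x y; rewrite /wge; lia. Qed.

Lemma geq_trans : transitive geq.
Proof. by move=> y x z; rewrite /=; lia. Qed.

Lemma geq_anti : antisymmetric geq.
Proof. by move=> x y; rewrite /=; lia. Qed.

Lemma gtn_trans : transitive gtn.
Proof. by move=> y x z; rewrite /=; lia. Qed.

Lemma gtn_anti : antisymmetric gtn.
Proof. by move=> x y; rewrite /=; lia. Qed.

Lemma size_unshift u : size (unshift u) = (size u).*2.
Proof. by elim: u => [//|v u IH] /=; rewrite IH. Qed.

Lemma leq_size_sumn_unshift u : size u <= sumn (unshift u).
Proof. by elim: u => [//|v u IH] /=; lia. Qed.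

Lemma B_tokens t u : valid_tokens t -> perm_eq u (token_weights t) -> sorted wge u ->
  B (token_parts t) = [seq x <- unshift u | 0 < x].
Proof.
move=> ok pu su; rewrite /B bressoud_pairs_tokens // size_unshift.
set k := (_ * _).
have [|u' [-> pu' su']] :=
  @interchange_iterE k _ (bressoud_weight_tokens ok) (presorted_tokens ok).
  (* Both factors of the fuel exceed the number of pairs, since every pair has a positive sum. *)
  apply: leq_trans (inversions_le _) _; rewrite /k.
  by apply: leq_mul; have := leq_size_sumn_unshift (token_weights t); lia.
congr (filter _ (unshift _)).
apply: (sorted_eq wge_trans wge_anti su' su).
by rewrite (perm_trans pu') // perm_sym.
Qed.

(** Comparing with the first token of [t] is enough, as its [m] is the largest. The term [(t ==
    [::]) * 4] makes the inequality void for an empty tail. *)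
Lemma tokens_cons_parts b m t : valid_tokens t -> ~~ odd m -> b ==> (0 < m + size t) ->
  head 0 (token_parts t) + 4 <= m + 4 * size t + (t == [::]) * 4 + 1 ->
  valid_tokens ((b, m) :: t).
Proof.
move=> ok ev pos; case: t ok pos => [|[b' m'] t] ok pos.
  by rewrite /= ev pos.
rewrite token_parts_head [head _ _]/= => hd.
have /and4P[_ _ bd _] : [&& _, _, _ & _] := ok.
apply/and4P; split=> //; apply/andP; split; first by move: hd => /=; lia.
by apply: sub_all bd => x; move: hd => /=; lia.
Qed.

(** Greedy reading from the largest part: two parts differing by 2 form a pair, otherwise the
    largest part is a single token. *)
Lemma tokens_of_parts s : all odd s -> sorted gtn s ->
  exists2 t, valid_tokens t & token_parts t = s.
Proof.
elim: (size s) {-2}s (leqnn (size s)) => {s} [|n IH] [|x [|y s]] // len od dec.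
- by exists [::].
- by exists [::].
- exists [:: (false, x.-1)]; first by move: od => /=; lia.
  by move: od => /= od; congr [:: _]; lia.
have [xy|xy] := eqVneq x y.+2.
  have [||| t ok tE] := IH s.
  - by move: len => /=; lia.
  - by case/and3P: od.
  - by move: dec => /= /andP[_ /path_sorted].
  have hd : head 0 (token_parts t) + 2 <= y + (t == [::]) * 2.
    rewrite tE; case: s {IH len} od dec tE => [|z s] /=.
      by case: t ok => [|[[] m] t] //= _; lia.
    by case: t ok => [|[[] m] t] //= _; lia.
  (* This keeps [x.-1 - 4 * size t], the solution [m] of [x = m + 4 * size t + 1], from being
     truncated. *)
  have sz : 4 * size t <= head 0 (token_parts t) + (t != [::]) * 3.
    by case: t {ok tE hd} => [|[[] m] t] /=; lia.
  exists ((true, x.-1 - 4 * size t) :: t); first apply: tokens_cons_parts => //.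
  - by move: od => /=; lia.
  - by case: t {ok tE} hd sz => [|? ?] /=; move: od => /=; lia.
  - by case: t {ok tE} hd sz => [|? ?] /=; move: od => /=; lia.
  have -> /= : token_parts ((true, x.-1 - 4 * size t) :: t)
     = [:: (x.-1 - 4 * size t + 4 * size t).+1,
           (x.-1 - 4 * size t + 4 * size t).-1 & token_parts t] by [].
  rewrite tE; congr [:: _, _ & _].
    by case: t {ok tE} hd sz => [|? ?] /=; move: od => /=; lia.
  by case: t {ok tE} hd sz => [|? ?] /=; move: od => /=; lia.
have [||| t ok tE] := IH (y :: s).
- by move: len => /=; lia.
- by case/andP: od.
- by move: dec => /= /andP[].
have tN0 : t != [::] by case: t tE {ok}.
have hd : head 0 (token_parts t) = y by rewrite tE.
have sz : 4 * size t <= y + 3.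
  by rewrite -hd; case: t {ok tE hd} tN0 => [|[[] m] t] //=; lia.
exists ((false, x.-1 - 4 * size t) :: t); first apply: tokens_cons_parts => //.
- by move: od dec => /=; lia.
- by rewrite hd; move: od dec => /=; lia.
rewrite /= tE; congr (_ :: _); by move: od dec => /=; lia.
Qed.

Lemma token_parts_odd t : valid_tokens t -> all odd (token_parts t).
Proof.
elim: t => [//|[b m] t IH] /= /and4P[ev pos bd ok].
by case: b pos => /=; rewrite (IH ok) ?andbT; lia.
Qed.

Lemma token_parts_sorted t : valid_tokens t -> sorted gtn (token_parts t).
Proof.
elim: t => [//|[b m] t IH] /= /and4P[ev pos bd /[dup] ok /IH].
rewrite (token_parts_head t); case: t {IH} bd ok pos => [|[b' m'] t].
  by case: b => //=; lia.
case: b => /= /andP[le_m _] ok pos ->; lia.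
Qed.

(** * Correspondence between token lists and multisets of weights *)

(** Both claims come from [token_weights_bound] with [M = m]. If [m' = m], the even weight of a pair
    exceeds the bound for the tail, so it is the weight of the head, which must then be a pair. *)
Lemma token_weights_head_le b m t b' m' t' :
  valid_tokens ((b, m) :: t) -> valid_tokens ((b', m') :: t') -> size t' = size t ->
  (if b' then 2 * m' + 4 * size t' else m'.+1) \in token_weights ((b, m) :: t) ->
  m' <= m /\ (m' = m -> b' -> b).
Proof.
move=> ok /= /and4P[ev' _ _ _] -> v'_in.
have /and4P[ev pos bd okt] : [&& _, _, _ & _] := ok.
have bound : all (fun x => x.2 <= m) ((b, m) :: t) by rewrite /= leqnn.
have le_m := allP (token_weights_bound ok bound) _ v'_in.
split; first by move: ev ev' le_m; clear; case: b' => /=; case: ifP; lia.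
move=> mE b'T; move: v'_in; rewrite b'T mE /= in_cons.
case: b {ok bound le_m pos} => //= /orP[|/(allP (token_weights_bound okt bd))].
  by lia.
by case: ifP; lia.
Qed.

(* The head of the list realises the maximum of the values m, and it is a pair
   exactly when the corresponding even weight is present. *)
Lemma token_weights_inj t t' : valid_tokens t -> valid_tokens t' ->
  perm_eq (token_weights t) (token_weights t') -> t = t'.
Proof.
elim: t t' => [|[b m] t IH] [|[b' m'] t'] ok ok' //.
- by move=> /perm_size.
- by move=> /perm_size.
move=> pE; have [sz] := perm_size pE; rewrite !size_token_weights in sz.
have [|le1 b1] := token_weights_head_le ok ok' (esym sz).
  by rewrite (perm_mem pE) /= mem_head.
have [|le2 b2] := token_weights_head_le ok' ok sz.
  by rewrite -(perm_mem pE) /= mem_head.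
have mE : m = m' by lia.
have bE : b = b' by case: b b' {pE ok ok'} b1 b2 => [] [] //=; lia.
rewrite mE bE in pE ok *; congr (_ :: _); apply: IH.
- by case/and4P: ok.
- by case/and4P: ok'.
- by move: pE; rewrite /= sz perm_cons.
Qed.

Lemma tokens_cons_val b m t : valid_tokens t -> ~~ odd m -> b ==> (0 < m + size t) ->
  all (fun y => if odd y then y <= m.+1 else y <= 2 * m + 4 * (size t).-1)
      (token_weights t) ->
  valid_tokens ((b, m) :: t).
Proof.
move=> ok ev pos; case: t ok pos => [|[b' m'] t] ok pos.
  by rewrite /= ev pos.
move=> /= /andP[hd _]; have /and4P[ev' _ bd _] : [&& _, _, _ & _] := ok.
have le_m : m' <= m.
  by move: ev ev' hd; clear; case: b' => /=; case: ifP; lia.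
apply/and4P; split=> //; apply/andP; split=> //.
by apply: sub_all bd => x /=; lia.
Qed.

(** Solves [e = 2 * m + 4 * size t] for [m]; divisibility by 4 makes [m] even, and [4 * size t <= e]
    makes the subtraction exact. *)
Lemma token_cons_pair e t : valid_tokens t -> 0 < e -> 4 %| e -> 4 * size t <= e ->
  all (fun y => if odd y then y + 2 * size t <= e./2.+1 else y + 4 <= e)
      (token_weights t) ->
  exists2 t', valid_tokens t' & token_weights t' = e :: token_weights t.
Proof.
move=> ok e0 e4 le_e ub; exists ((true, e./2 - 2 * size t) :: t); last first.
  by congr (_ :: _); lia.
apply: tokens_cons_val => //; [lia | lia |].
apply: sub_all ub => y; case: ifP; lia.
Qed.

Lemma token_cons_single o t : valid_tokens t -> odd o ->
  all (fun y => if odd y then y <= o else y <= 2 * o.-1 + 4 * (size t).-1)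
      (token_weights t) ->
  exists2 t', valid_tokens t' & token_weights t' = o :: token_weights t.
Proof.
move=> ok oo ub; exists ((false, o.-1) :: t); last first.
  by congr (_ :: _); lia.
apply: tokens_cons_val => //; first by lia.
apply: sub_all ub => y; case: ifP; lia.
Qed.

Lemma sorted_mult4_bound e es : path gtn e es ->
  all (fun y => (0 < y) && (4 %| y)) (e :: es) -> 4 * (size es).+1 <= e.
Proof.
elim: es e => [|e' es IH] e /=; first by lia.
move=> /andP[lt_e pe] /and3P[me me' mes].
by have := IH e' pe; rewrite /= me' mes => /(_ isT); lia.
Qed.

(** Existence counterpart of [token_weights_inj]. The first token carries the largest odd or the
    largest even weight, whichever has the larger [m]. *)
Lemma tokens_exist os es : sorted geq os -> all odd os ->
  sorted gtn es -> all (fun y => (0 < y) && (4 %| y)) es ->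
  exists2 t, valid_tokens t & perm_eq (token_weights t) (os ++ es).
Proof.
move: {2}(size os + size es) (leqnn (size os + size es)) => n.
elim: n os es => [|n IH] [|o os] [|e es] // le_n so oo se me;
  try by exists [::].
- have [|||||t ok pt] := IH [::] es; rewrite ?(path_sorted se) //.
  + by case/andP: me.
  have sz : size t = size es by rewrite -size_token_weights (perm_size pt).
  have eb := sorted_mult4_bound se me.
  have [||||t' ok' tE] := token_cons_pair (e := e) ok.
  + by move: me => /= /andP[] /andP[].
  + by move: me => /= /andP[] /andP[].
  + by rewrite sz; lia.
  + rewrite (perm_all _ pt) /=; apply/allP => y y_in.
    have /= := allP (order_path_min gtn_trans se) _ y_in.
    have /andP[me1 mes] := me; have := allP mes _ y_in.
    by case: ifP; lia.
  by exists t'; rewrite // tE perm_cons.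
- have [|||||t ok pt] := IH os [::]; rewrite ?(path_sorted so) //.
  + by case/andP: oo.
  have [||t' ok' tE] := token_cons_single (o := o) ok.
  + by case/andP: oo.
  + rewrite (perm_all _ pt) cats0; apply/allP => y y_in.
    have /= := allP (order_path_min geq_trans so) _ y_in.
    have /andP[oo1 oos] := oo; have := allP oos _ y_in.
    by case: ifP; lia.
  by exists t'; rewrite // tE perm_cons.
have osE y : y \in os -> odd y && (y <= o).
  move=> y_in; have /= := allP (order_path_min geq_trans so) _ y_in.
  by have /andP[_ oos] := oo; have := allP oos _ y_in; lia.
have esE y : y \in es -> (4 %| y) && (y < e).
  move=> y_in; have /= := allP (order_path_min gtn_trans se) _ y_in.
  by have /andP[_ mes] := me; have := allP mes _ y_in; lia.
have /andP[o1 _] := oo; have /andP[e1 mes] := me.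
(* Compares [m = o - 1] for a single part with [m = e / 2 - 2 k] for a pair, where [k] tokens
   follow. A tie goes to the pair: placed second it would have [m] larger by 2. *)
have [le_oe|lt_eo] := leqP (o + 2 * (size os + size es).+1) e./2.+1.
- have [|||||t ok pt] := IH (o :: os) es; rewrite ?(path_sorted se) //.
  + by move: le_n => /=; lia.
  have sz : size t = (size os + size es).+1.
    by rewrite -size_token_weights (perm_size pt) /= size_cat.
  have [||||t' ok' tE] := token_cons_pair (e := e) ok.
  + by lia.
  + by lia.
  + by lia.
  + rewrite (perm_all _ pt) sz; clear IH le_n so oo se me mes ok pt sz.
    apply/allP => y; rewrite mem_cat in_cons.
    by case/orP => [/predU1P[->|/osE]|/esE]; case: ifP; lia.
  exists t'; rewrite // tE perm_sym (perm_catCA _ [:: e]) /=.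
  by rewrite perm_cons perm_sym.
have [|||||t ok pt] := IH os (e :: es); rewrite ?(path_sorted so) //.
- by case/andP: oo.
have sz : size t = (size os + size es).+1.
  by rewrite -size_token_weights (perm_size pt) /= size_cat addnS.
have [||t' ok' tE] := token_cons_single (o := o) ok => //.
(* Parity gains one unit for [e]: [e / 2] is even while [o] is odd, so the strict inequality [lt_eo]
   improves to the required bound. *)
- rewrite (perm_all _ pt) sz; clear IH le_n so oo se me mes ok pt sz.
  apply/allP => y; rewrite mem_cat in_cons.
  by case/orP => [/osE|/predU1P[->|/esE]]; case: ifP; lia.
by exists t'; rewrite // tE perm_cons.
Qed.

(** * Coding partitions into distinct parts by weights and column counts *)

Notation positives g := [seq x <- g | 0 < x].

(* The pairs with shifted weights u, to which 2 c_j columns of height 2 j + 1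
   are added; only meaningful when u and c have the same size. *)
Fixpoint gam (u c : seq nat) : seq nat :=
  match u, c with
  | v :: u', d :: c' =>
      (v + 4 * size u')./2.+1 + 2 * d + 2 * sumn c' ::
      (v + 4 * size u').-1./2 + 2 * sumn c' :: gam u' c'
  | _, _ => [::]
  end.

Lemma gam_nseq0 u : gam u (nseq (size u) 0) = unshift u.
Proof. by elim: u => [//|v u IH] /=; rewrite IH sumn_nseq !addn0. Qed.

Lemma size_gam u c : size c = size u -> size (gam u c) = (size u).*2.
Proof. by elim: u c => [|v u IH] [|d c] //= [/IH ->]. Qed.

(** Every pair but the last has weight at least 5 before unshifted columns are added, so only the
    second entry of the last pair can vanish. *)
Lemma gam_trailing u c : size c = size u -> all (leq 1) u ->
  exists2 g, all (leq 1) g & gam u c = g \/ gam u c = rcons g 0.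
Proof.
elim: u c => [|v u IH] [|d c] //; first by exists [::] => //; left.
move=> [/[dup] sz /IH {}IH] /andP[v0 /IH [g g0 gE]].
case: u sz g0 gE {IH} => [|v' u] sz g0 gE.
  case: c sz gE => [|//] _ gE /=.
  have [w1|w1] := posnP (v + 4 * 0).-1./2.
    exists [:: (v + 4 * 0)./2.+1 + 2 * d + 2 * 0] => //=; right.
    by rewrite w1.
  by exists [:: (v + 4 * 0)./2.+1 + 2 * d + 2 * 0; (v + 4 * 0).-1./2 + 2 * 0];
    [rewrite /=; lia | left].
exists [:: (v + 4 * size (v' :: u))./2.+1 + 2 * d + 2 * sumn c,
           (v + 4 * size (v' :: u)).-1./2 + 2 * sumn c & g].
  by rewrite /= g0; lia.
by case: gE => gE; [left | right]; rewrite [LHS]/= -/(gam (v' :: u) c) gE.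
Qed.

Lemma positives_id g : all (leq 1) g -> positives g = g.
Proof. exact: all_filterP. Qed.

(** The padded list has even length, so the parity of what remains tells whether a zero was
    discarded. *)
Lemma gam_positives u c : size c = size u -> all (leq 1) u ->
  gam u c = positives (gam u c) ++ nseq (odd (size (positives (gam u c)))) 0.
Proof.
move=> sz u0; have := size_gam sz.
have [g g0 [->|->]] := gam_trailing sz u0.
  by rewrite positives_id // => ->; rewrite odd_double cats0.
rewrite size_rcons filter_rcons /= positives_id // => szg.
by have -> : odd (size g); [lia | rewrite cats1].
Qed.

Lemma positives_ins_rcons t g :
  positives (ins t (rcons g 0)) = positives (ins t g).
Proof.
elim: t g => [|t IH] [|x [|y g]] //=; rewrite ?filter_rcons //=.
- by case: ifP => //= _; case: ifP.
- by case: ifP => _ //=; rewrite ?drop0 ?filter_rcons ?IH.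
Qed.

Lemma positives_ins_gam t u c : size c = size u -> all (leq 1) u ->
  positives (ins t (positives (gam u c))) = positives (ins t (gam u c)).
Proof.
move=> sz u0; have [g g0 [->|->]] := gam_trailing sz u0.
  by rewrite (positives_id g0).
by rewrite filter_rcons /= (positives_id g0) positives_ins_rcons.
Qed.

(** Where two pairs meet, the columns add the same amount to both entries, and strict decrease there
    is what [wge] says about the weights. *)
Lemma gam_sorted u c : size c = size u -> all (leq 1) u -> sorted wge u ->
  sorted gtn (gam u c).
Proof.
elim: u c => [|v u IH] [|d c] // [sz] /andP[v0 u0] /[dup] su /path_sorted su'.
have := IH c sz u0 su'; case: u sz u0 su {IH su'} => [|v' u] //.
  by case: c => [|//] _ _ _ _ /=; lia.
case: c => [//|d' c] [sz] _ /= /andP[vv' _] ->; rewrite andbT.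
by move: vv'; rewrite /wge; lia.
Qed.

Lemma gam_inj u c u' c' : size c = size u -> size c' = size u' ->
  all (leq 1) u -> all (leq 1) u' -> gam u c = gam u' c' ->
  u = u' /\ c = c'.
Proof.
elim: u c u' c' => [|v u IH] [|d c] [|v' u'] [|d' c'] //.
move=> [sz] [sz'] /andP[v0 u0] /andP[v0' u0'] [e1 e2 e3].
have [uE cE] := IH _ _ _ sz sz' u0 u0' e3; subst u' c'.
by have [-> ->] : v = v' /\ d = d' by lia.
Qed.

Lemma positives_gam_inj u c u' c' : size c = size u -> size c' = size u' ->
  all (leq 1) u -> all (leq 1) u' -> positives (gam u c) = positives (gam u' c') ->
  u = u' /\ c = c'.
Proof.
move=> sz sz' u0 u0' E; apply: gam_inj => //.
by rewrite gam_positives // E -gam_positives.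
Qed.

(** Inverse of the coding, built from the smallest parts upwards. *)
Lemma gam_exists g : sorted gtn g -> all (leq 1) g ->
  exists u c, [/\ size c = size u, all (leq 1) u, sorted wge u
    & positives (gam u c) = g].
Proof.
elim: (size g) {-2}g (leqnn (size g)) => {g} [|n IH] [|x [|y g]] // len sg g0.
- by exists [::], [::].
- by exists [::], [::].
(* A lone last part is paired with 0; removing column pairs of height 1 leaves 1 or 2. *)
- exists [:: x - 2 * x.-1./2], [:: x.-1./2]; split=> //=.
    by move: g0 => /=; lia.
  rewrite ifF; last by lia.
  by congr [:: _]; move: g0 => /=; lia.
have [|||u [c [sz u0 su uE]]] := IH g.
- by move: len => /=; lia.
- by move: sg => /= /andP[_ /path_sorted].
- by case/and3P: g0.
(* The next part is below [y], also after its own column pairs are removed: this makes the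
   subtractions in the new weight exact. *)
have hd : if u is v :: u' then (v + 4 * size u')./2.+1 + 2 * sumn c < y
          else sumn c = 0.
  case: u c sz {u0 su} uE => [|v u] [|d c] //= _; case: g sg {IH len g0} => [//|z g].
  by move=> /= /and3P[_ yz _] [zE _]; move: yz; rewrite -zE; lia.
have xy : y < x by move: sg => /= /andP[].
(* Reduces the difference of the pair to 1 or 2. *)
pose d := (x - y).-1./2.
pose v := (x - 2 * d - 2 * sumn c) + (y - 2 * sumn c) - 4 * size u.
have y0 : 0 < y by case/and3P: g0.
have [vE1 vE2 v0] : [/\ (v + 4 * size u)./2.+1 + 2 * d + 2 * sumn c = x,
    (v + 4 * size u).-1./2 + 2 * sumn c = y & 0 < v].
  by split; rewrite /v /d; case: u {sz uE v} u0 su hd => [|v' u] /=; lia.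
exists (v :: u), (d :: c); split.
- by rewrite /= sz.
- by rewrite /= v0.
- case: u {sz uE} u0 su hd @v v0 vE1 vE2 => [|v' u] //= u0 -> hd v0 vE1 vE2.
  by rewrite andbT /wge; lia.
by rewrite /= vE1 vE2 uE y0.
Qed.

(** * One insertion: two new columns or a new weight *)

Lemma sumn_incr_nth c i : sumn (incr_nth c i) = (sumn c).+1.
Proof.
elim: c i => [|d c IH] [|i] //=; last by rewrite IH addnS.
by rewrite sumn_ncons.
Qed.

(** More than [t] pairs make each first entry too large for the test of [ins], so the insertion
    passes [t] pairs and ends by adding 2 to the next entry: two columns of height [2 * t + 1]. *)
Lemma ins_gam t u c : size c = size u -> all (leq 1) u -> t < size u ->
  ins t (gam u c) = gam u (incr_nth c t).
Proof.
elim: t u c => [|t IH] [|v u] [|d c] // [sz] /andP[v0 u0] lt_t.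
  by rewrite /=; congr (_ :: _); lia.
have ltt : t < size u by [].
have sI : sumn (incr_nth c t) = (sumn c).+1.
  by rewrite sumn_incr_nth.
rewrite [RHS]/= -IH // sI [LHS]/= ifF /= ?drop0; last by lia.
by congr [:: _, _ & _]; lia.
Qed.

Fixpoint insv (v : nat) (u : seq nat) : seq nat :=
  if u is x :: u' then if x < v then v :: u else x :: insv v u' else [:: v].

Lemma insv_perm v u : perm_eq (insv v u) (v :: u).
Proof.
elim: u => [//|x u IH] /=; case: ifP => // _.
rewrite -(perm_cons x) in IH; apply: perm_trans IH _.
by apply/permP=> p /=; rewrite addnCA.
Qed.

Lemma insv_sorted v u : sorted wge u -> v \notin u -> sorted wge (insv v u).
Proof.
case: u => [//|x u] /=; rewrite in_cons negb_or; elim: u x => [|y u IH] x /=.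
  by move=> _ /andP[vx _]; case: ifP => /=; rewrite /wge; lia.
move=> /andP[xy su] /andP[vx]; rewrite in_cons negb_or => v_out.
case: ifP => xv /=; first by rewrite xy su /wge; lia.
have := IH y su v_out; rewrite /=; case: ifP => yv /= ->; rewrite andbT //.
by rewrite /wge; lia.
Qed.

(** The difference [t - size u] is constant along the recursion, and the test of [ins] reads [v < w]
    for the new weight [w]. A pair that is passed has one more pair after it, hence its increase by
    2 and 2. *)
Lemma ins_unshift t u : all (leq 1) u -> size u <= t -> 
  4 * (t - size u) + 2 \notin u ->
  positives (ins t (unshift u)) =
  positives (unshift (insv (4 * (t - size u) + 2) u)).
Proof.
elim: u t => [|v u IH] t.
  case: t => [//|t] _ _ _; rewrite /= subn0 ifT; last by lia.
  by congr [:: _; _]; lia.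
case: t => [//|t] /andP[v0 u0] le_t; rewrite in_cons negb_or => /andP[vne v_out].
have sE : t.+1 - size (v :: u) = t - size u by [].
rewrite sE in vne v_out *.
have szI := perm_size (insv_perm (4 * (t - size u) + 2) u).
have {}IH := IH t u0 le_t v_out.
rewrite [insv _ _]/=; set w := 4 * _ + 2 in vne v_out szI IH *.
have c1 : ((v + 4 * size u)./2.+1 < t.+1.*2) = (v < w).
  by move: (le_t : size u <= t); rewrite /w; lia.
rewrite [ins _ _]/= c1; case: ifP => vw.
  rewrite [unshift (w :: _)]/=; congr (positives [:: _, _ & _]).
    by rewrite /w; lia.
  by rewrite /w; lia.
rewrite /= drop0 IH szI ifT; last by move=> /=; lia.
by congr [:: _, _ & _]; move=> /=; lia.
Qed.

(** * Sequences of insertions *)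

Definition fold_ins ts g := foldl (fun g t => positives (ins t g)) g ts.

(* Below, ts lists the numbers a_i - 1.  If new_pairs k ts holds, then each of
   these insertions, starting from k pairs, creates a new pair, and pair_weights
   are the shifted weights of these pairs. *)
Fixpoint pair_weights (k : nat) (ts : seq nat) : seq nat :=
  if ts is t :: ts' then 4 * (t - k) + 2 :: pair_weights k.+1 ts' else [::].

Fixpoint new_pairs (k : nat) (ts : seq nat) : bool :=
  if ts is t :: ts' then (k <= t) && new_pairs k.+1 ts' else true.

Lemma size_pair_weights k ts : size (pair_weights k ts) = size ts.
Proof. by elim: ts k => [//|t ts IH] k /=; rewrite IH. Qed.

(** As [ts] decreases and the number of pairs grows, the new weights strictly decrease. The last
    hypothesis carries this through the induction, so that each new weight is absent from [u]. *)
Lemma fold_ins_new ts u : new_pairs (size u) ts -> sorted geq ts ->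
  all (leq 1) u -> sorted wge u ->
  (if ts is t :: _ then
     all (fun x => (x %% 4 != 2) || (4 * (t - size u) + 2 < x)) u else true) ->
  exists u', [/\ fold_ins ts (positives (unshift u)) = positives (unshift u'),
    perm_eq u' (pair_weights (size u) ts ++ u) & sorted wge u'].
Proof.
elim: ts u => [|t ts IH] u /=; first by move=> _ _ _ su _; exists u.
move=> /andP[le_t new] st u0 su u2.
set w := 4 * _ + 2 in u2 *.
have w_out : w \notin u by apply/negP => /(allP u2); rewrite /w; lia.
have pI := insv_perm w u; have szI := perm_size pI.
have [||||| u' [uE1 uE2 uE3]] := IH (insv w u).
- by rewrite szI.
- exact: path_sorted st.
- by rewrite (perm_all _ pI) /= u0; lia.
- exact: insv_sorted.
- case: ts new st {IH} => [//|t' ts] /andP[le_t' _] /andP[/= le_tt _].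
  rewrite (perm_all _ pI) szI /=; apply/andP; split; first by rewrite /w; lia.
  by apply: sub_all u2 => x; rewrite /w; lia.
exists u'; split=> //; last first.
  apply/permP => p; rewrite (permP uE2) szI !count_cat (permP pI) /=.
  by rewrite count_cat addnCA.
rewrite -uE1 -(ins_unshift u0) // -{1}(gam_nseq0 u).
by rewrite positives_ins_gam ?size_nseq // gam_nseq0.
Qed.

Lemma fold_ins_columns ts u c : all (fun t => t < size u) ts ->
  size c = size u -> all (leq 1) u ->
  fold_ins ts (positives (gam u c)) = positives (gam u (foldl incr_nth c ts)).
Proof.
elim: ts c => [//|t ts IH] c /= /andP[lt_t lt_ts] sz u0.
rewrite positives_ins_gam // ins_gam //; apply: IH => //.
by rewrite size_incr_nth sz lt_t.
Qed.

Lemma size_foldl_incr_nth ts c : all (fun t => t < size c) ts ->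
  size (foldl incr_nth c ts) = size c.
Proof.
elim: ts c => [//|t ts IH] c /= /andP[lt_t lt_ts].
by rewrite IH size_incr_nth lt_t.
Qed.

Lemma nth_foldl_incr_nth ts c j :
  nth 0 (foldl incr_nth c ts) j = nth 0 c j + count_mem j ts.
Proof.
elim: ts c => [|t ts IH] c /=; first by rewrite addn0.
by rewrite IH nth_incr_nth -addnA addnCA.
Qed.

(** Once an index is below the number of pairs, so are all later ones. *)
Lemma new_pairs_split ts k : sorted geq ts -> exists ts1 ts2,
  [/\ ts = ts1 ++ ts2, new_pairs k ts1 & all (fun t => t < k + size ts1) ts2].
Proof.
elim: ts k => [|t ts IH] k st; first by exists [::], [::].
have [le_t|lt_t] := leqP k t.
  have [ts1 [ts2 [-> new lt]]] := IH k.+1 (path_sorted st).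
  exists (t :: ts1), ts2; rewrite /= le_t; split=> //.
  by rewrite addnS.
exists [::], (t :: ts); split=> //=; rewrite addn0 lt_t /=.
by apply: sub_all (order_path_min geq_trans st) => x /=; lia.
Qed.

Lemma pair_weights_sorted k ts : new_pairs k ts -> sorted geq ts ->
  sorted gtn (pair_weights k ts).
Proof.
elim: ts k => [//|t [//|t' ts] IH] k /andP[le_t new] /andP[le_tt st].
have := IH k.+1 new st; rewrite /= => ->; rewrite andbT.
by move: new le_tt => /= /andP[]; lia.
Qed.

Lemma pair_weights_mod k ts : all (fun v => v %% 4 == 2) (pair_weights k ts).
Proof. by elim: ts k => [//|t ts IH] k /=; rewrite IH; lia. Qed.

Lemma pair_weights_inj k ts ts' : new_pairs k ts -> new_pairs k ts' ->
  pair_weights k ts = pair_weights k ts' -> ts = ts'.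
Proof.
elim: ts k ts' => [|t ts IH] k [|t' ts'] //= /andP[le_t nw] /andP[le_t' nw'].
by move=> [tE /(IH _ _ nw nw') ->]; congr (_ :: _); lia.
Qed.

(** Solves [v = 4 * (t - k) + 2] with growing [k]. The final bound lets smaller column indices
    follow [ts] without breaking the order. *)
Lemma pair_weights_exists k vs : sorted gtn vs ->
  all (fun v => v %% 4 == 2) vs ->
  exists ts, [/\ new_pairs k ts, sorted geq ts, pair_weights k ts = vs
    & all (fun t => k + size vs <= t.+1) ts].
Proof.
elim: vs k => [|v vs IH] k svs; first by exists [::].
move=> /andP[v2 vs2].
have [ts [nw st tsE le_ts]] := IH k.+1 (path_sorted svs) vs2.
have tb : if ts is t' :: _ then (t' <= v %/ 4 + k) && (k + size vs < t'.+1)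
          else vs = [::].
  case: ts nw tsE le_ts {st} => [|t' ts] //=.
  move=> /andP[le_t' nw] tsE /andP[le_ts _]; apply/andP; split; last by lia.
  by move: svs vs2; rewrite -tsE /= => /andP[lt_v _] _; lia.
exists (v %/ 4 + k :: ts); split.
- by rewrite /= nw; lia.
- by case: ts {nw tsE le_ts} st tb => [|t' ts] //= -> /andP[-> _].
- by rewrite /= tsE; congr (_ :: _); lia.
rewrite /=; apply/andP; split; last by apply: sub_all le_ts => t; lia.
by case: ts tb {nw st tsE le_ts} => [->|t' ts] /=; lia.
Qed.

(** * Alternating sum, sum and number of odd parts *)

Lemma alt_sum_nil : alt_sum [::] = 0%R.
Proof. by rewrite /alt_sum big_ord0. Qed.

Lemma alt_sum_cons x s : alt_sum (x :: s) = (x%:Z - alt_sum s)%R.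
Proof.
rewrite /alt_sum /= big_ord_recl expr0 mul1r; congr (_ + _)%R.
by rewrite -sumrN; apply: eq_bigr => i _; rewrite exprS mulN1r mulNr.
Qed.

Lemma alt_sum_rcons0 s : alt_sum (rcons s 0) = alt_sum s.
Proof.
elim: s => [|x s IH]; first by rewrite alt_sum_cons alt_sum_nil subr0.
by rewrite rcons_cons !alt_sum_cons IH.
Qed.

(** A pair contributes its difference: 1 or 2 according to the parity of its weight, plus
    [2 * d]. *)
Lemma alt_sum_gam u c : size c = size u -> all (leq 1) u ->
  alt_sum (positives (gam u c)) =
  Posz (size u + count (fun v => ~~ odd v) u + 2 * sumn c).
Proof.
move=> sz u0; have -> : alt_sum (positives (gam u c)) = alt_sum (gam u c).
  have [g g0 [->|->]] := gam_trailing sz u0; first by rewrite (positives_id g0).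
  by rewrite filter_rcons (positives_id g0) alt_sum_rcons0.
elim: u c sz u0 => [|v u IH] [|d c] //; first by rewrite alt_sum_nil.
move=> [sz] /andP[v0 u0]; rewrite [gam _ _]/= 2!alt_sum_cons (IH _ sz u0) /=.
lia.
Qed.

Lemma sumn_positives s : sumn (positives s) = sumn s.
Proof. by elim: s => [//|[|x] s IH] /=; rewrite IH. Qed.

Lemma count_odd_positives s : count odd (positives s) = count odd s.
Proof. by elim: s => [//|[|x] s IH] /=; rewrite IH. Qed.

Lemma sumn_ins t g : sumn (ins t g) = sumn g + (4 * t + 2).
Proof.
elim: t g => [|t IH] g /=; first by case: g => [|x g] /=; lia.
case: ifP => _ /=; first by lia.
by rewrite IH; case: g => [|x [|y g]] /=; rewrite ?drop0; lia.
Qed.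

Lemma count_odd_ins t g : count odd (ins t g) = count odd g.
Proof.
elim: t g => [|t IH] g /=; first by case: g => [|x g] //=; rewrite negbK.
case: ifP => _ /=; first by lia.
by rewrite IH !negbK; case: g => [|x [|y g]] /=; rewrite ?drop0.
Qed.

Lemma sumn_fold_ins ts g :
  sumn (fold_ins ts g) = sumn g + sumn [seq 4 * t + 2 | t <- ts].
Proof.
elim: ts g => [|t ts IH] g /=; first by rewrite addn0.
by rewrite /fold_ins /= IH sumn_positives sumn_ins -addnA.
Qed.

Lemma count_odd_fold_ins ts g : count odd (fold_ins ts g) = count odd g.
Proof.
elim: ts g => [//|t ts IH] g.
by rewrite /fold_ins /= IH count_odd_positives count_odd_ins.
Qed.

(** The shifts sum to [4 * 'C(k, 2)] for [k] pairs. The total thus depends only on the multiset of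
    weights, so sorting preserves it. *)
Lemma sumn_unshift u : all (leq 1) u ->
  sumn (unshift u) + 2 * size u = sumn u + 2 * (size u * size u).
Proof. by elim: u => [//|v u IH] /= /andP[v0 /IH]; lia. Qed.

(** An odd weight gives two consecutive integers, a multiple of 4 two odd ones. *)
Lemma count_odd_unshift u : all bressoud_weight u ->
  count odd (unshift u) = size u + count (fun v => ~~ odd v) u.
Proof.
elim: u => [//|v u IH] /= /andP[+ /IH ->]; rewrite /bressoud_weight.
by lia.
Qed.

Lemma size_token_parts t :
  valid_tokens t -> size (token_parts t) = size t + count (fun v => ~~ odd v) (token_weights t).
Proof.
elim: t => [//|[b m] t IH] /= /and4P[ev _ _ /IH szE].
by case: b => /=; rewrite szE; lia.
Qed.

Lemma sumn_token_parts t :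
  valid_tokens t -> sumn (token_parts t) = sumn (unshift (token_weights t)).
Proof.
elim: t => [//|[b m] t IH] /= /and4P[ev pos _ /IH sE].
by case: b pos => /=; rewrite sE size_token_weights; lia.
Qed.

Lemma bressoud_weight_gt0 u : all bressoud_weight u -> all (leq 1) u.
Proof. by apply: sub_all => v /andP[]. Qed.

Lemma token_weights_sort t : valid_tokens t ->
  exists2 u, perm_eq u (token_weights t) & sorted wge u.
Proof.
move=> ok; have [u [_ pu su]] := interchange_iterE (bressoud_weight_tokens ok)
  (presorted_tokens ok) (leqnn _).
by exists u.
Qed.

Lemma sumn_B_tokens t : valid_tokens t -> sumn (B (token_parts t)) = sumn (token_parts t).
Proof.
move=> ok; have [u pu su] := token_weights_sort ok.
have bu : all bressoud_weight u by rewrite (perm_all _ pu) bressoud_weight_tokens.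
have := sumn_unshift (bressoud_weight_gt0 bu).
have := sumn_unshift (bressoud_weight_gt0 (bressoud_weight_tokens ok)).
rewrite (B_tokens ok pu su) sumn_positives (sumn_token_parts ok).
by rewrite (perm_size pu) (perm_sumn pu) => <- /addIn.
Qed.

Lemma count_odd_B_tokens t :
  valid_tokens t -> count odd (B (token_parts t)) = size (token_parts t).
Proof.
move=> ok; have [u pu su] := token_weights_sort ok.
rewrite (B_tokens ok pu su) count_odd_positives size_token_parts //.
rewrite count_odd_unshift; last by rewrite (perm_all _ pu) bressoud_weight_tokens.
by rewrite (perm_size pu) (permP pu) size_token_weights.
Qed.

Lemma fold_ins_B_tokens t ts1 ts2 : valid_tokens t -> sorted geq ts1 ->
  new_pairs (size t) ts1 -> all (fun i => i < size t + size ts1) ts2 ->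
  exists u, [/\ perm_eq u (pair_weights (size t) ts1 ++ token_weights t), sorted wge u
    & fold_ins (ts1 ++ ts2) (B (token_parts t)) =
      positives (gam u (foldl incr_nth (nseq (size u) 0) ts2))].
Proof.
move=> ok st1 nw lt2; have [u0 pu0 su0] := token_weights_sort ok.
have bu : all bressoud_weight u0.
  by rewrite (perm_all _ pu0) bressoud_weight_tokens.
have sz0 : size u0 = size t by rewrite (perm_size pu0) size_token_weights.
have [||||| u [uE pu su]] := @fold_ins_new ts1 u0 => //.
- by rewrite sz0.
- exact: bressoud_weight_gt0.
(* No weight coming from [B] is 2 modulo 4. *)
- case: (ts1) => // i _; apply: sub_all bu => x.
  by rewrite /bressoud_weight; lia.
have {}pu : perm_eq u (pair_weights (size t) ts1 ++ token_weights t).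
  by rewrite sz0 in pu; apply: perm_trans pu _; rewrite perm_cat2l.
have szu : size u = size t + size ts1.
  by rewrite (perm_size pu) size_cat size_pair_weights size_token_weights addnC.
exists u; split=> //; rewrite /fold_ins foldl_cat -/(fold_ins ts1 _).
rewrite (B_tokens ok pu0 su0) uE -gam_nseq0 -/(fold_ins ts2 _).
rewrite fold_ins_columns ?size_nseq ?szu //.
rewrite (perm_all _ pu) all_cat (bressoud_weight_gt0 (bressoud_weight_tokens ok)).
by rewrite andbT; apply: sub_all (pair_weights_mod _ _) => x; lia.
Qed.

(** * Splitting a partition into doubled parts and distinct parts *)

Lemma count_mem_flatten_nseq (m : nat -> nat) s i : uniq s ->
  count_mem i (flatten [seq nseq (m j) j | j <- s]) = (i \in s) * m i.
Proof.
elim: s => [//|j s IH] /= /andP[j_out /IH {}IH].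
rewrite count_cat count_nseq IH in_cons /= eq_sym.
by case: eqVneq => [->|_] //=; rewrite ?(negPf j_out); lia.
Qed.

Lemma geq_total : total geq.
Proof. by move=> x y; rewrite /=; lia. Qed.

Lemma perm_count_mem (s s' : seq nat) :
  (forall i, count_mem i s = count_mem i s') -> perm_eq s s'.
Proof. by move=> E; apply/allP => x _; apply/eqP/E. Qed.

Lemma count_mem_beta_part l i : count_mem i (beta_part l) = odd (mult l i).
Proof.
rewrite /beta_part (permP (introT permPl (perm_sort _ _))).
rewrite count_uniq_mem ?filter_uniq ?undup_uniq // mem_filter mem_undup.
rewrite /mult; case: (boolP (i \in l)) => [|i_out]; first by rewrite andbT.
by rewrite (count_memPn i_out).
Qed.

Lemma count_mem_alpha_part l i : count_mem i (alpha_part l) = (mult l i)./2.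
Proof.
rewrite /alpha_part (permP (introT permPl (perm_sort _ _))).
rewrite count_mem_flatten_nseq ?undup_uniq // mem_undup /mult.
case: (boolP (i \in l)) => [|i_out]; first by rewrite mul1n.
by rewrite (count_memPn i_out).
Qed.

Lemma alpha_beta_perm l :
  perm_eq l (beta_part l ++ alpha_part l ++ alpha_part l).
Proof.
apply: perm_count_mem => i.
rewrite !count_cat count_mem_beta_part count_mem_alpha_part addnn.
by rewrite odd_double_half.
Qed.

Lemma alpha_part_sorted l : sorted geq (alpha_part l).
Proof. exact: (sort_sorted geq_total). Qed.

Lemma beta_part_sorted l : sorted gtn (beta_part l).
Proof.
rewrite gtn_sorted_uniq_geq sort_uniq filter_uniq ?undup_uniq //=.
exact: (sort_sorted geq_total).
Qed.

Lemma alpha_beta_odd l : all odd l ->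
  all odd (alpha_part l) /\ all odd (beta_part l).
Proof. by rewrite (perm_all _ (alpha_beta_perm l)) !all_cat => /and3P[]. Qed.

Lemma alpha_beta_sort a b : sorted geq a -> sorted gtn b ->
  let l := sort geq (b ++ a ++ a) in alpha_part l = a /\ beta_part l = b.
Proof.
move=> sa; rewrite gtn_sorted_uniq_geq => /andP[ub sb] l.
have mE i : mult l i = (i \in b) + (count_mem i a).*2.
  rewrite /mult (permP (introT permPl (perm_sort _ _))) !count_cat addnn.
  by rewrite (count_uniq_mem _ ub).
split; apply: (sorted_eq geq_trans geq_anti) => //.
- exact: alpha_part_sorted.
- apply: perm_count_mem => i; rewrite count_mem_alpha_part mE; lia.
- by have := beta_part_sorted l; rewrite gtn_sorted_uniq_geq => /andP[].
apply: perm_count_mem => i; rewrite count_mem_beta_part mE (count_uniq_mem _ ub).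
by rewrite oddD odd_double addbF; case: (i \in b).
Qed.

(** * The map [Phi]: normal form, statistics and bijectivity *)

Lemma PhiE l : all odd (alpha_part l) ->
  Phi l = fold_ins [seq x./2 | x <- alpha_part l] (B (beta_part l)).
Proof.
rewrite /Phi /fold_ins; elim: (alpha_part l) (B _) => [//|x a IH] g /andP[xo ao].
rewrite /= -IH //; congr foldl; rewrite /I.
by have -> : x.+1./2.-1 = x./2 by lia.
Qed.

(** Normal form of the image: [ts1] collects the insertions that create pairs, [ts2] those that add
    columns. *)
Lemma Phi_data l : all odd l -> exists t ts1 ts2 u,
  [/\ valid_tokens t /\ token_parts t = beta_part l,
      [seq x./2 | x <- alpha_part l] = ts1 ++ ts2 /\ sorted geq (ts1 ++ ts2),
      new_pairs (size t) ts1 /\ all (fun i => i < size t + size ts1) ts2,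
      perm_eq u (pair_weights (size t) ts1 ++ token_weights t) /\ sorted wge u
    & Phi l = positives (gam u (foldl incr_nth (nseq (size u) 0) ts2))].
Proof.
move=> /alpha_beta_odd[ao bo]; rewrite PhiE //.
have [t ok tE] := tokens_of_parts bo (beta_part_sorted l).
have st : sorted geq [seq x./2 | x <- alpha_part l].
  rewrite sorted_map; apply: sub_sorted (alpha_part_sorted l) => x y /=.
  exact: half_leq.
have [ts1 [ts2 [tsE nw lt2]]] := new_pairs_split (size t) st.
rewrite tsE in st *; have [st1 _] := cat_sorted2 st.
have [u [pu su uE]] := fold_ins_B_tokens ok st1 nw lt2.
by exists t, ts1, ts2, u; rewrite -tE.
Qed.

Lemma sumn_Phi l : all odd l -> sumn (Phi l) = sumn l.
Proof.
move=> lo; have [ao bo] := alpha_beta_odd lo.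
rewrite PhiE // sumn_fold_ins (perm_sumn (alpha_beta_perm l)) !sumn_cat.
have [t ok <-] := tokens_of_parts bo (beta_part_sorted l).
rewrite (sumn_B_tokens ok); congr (_ + _).
(* Inserting for [x = 2 * t + 1] adds [4 * t + 2], the two copies of [x]. *)
by elim: (alpha_part l) ao => [//|x a IH] /= /andP[xo /IH ->]; lia.
Qed.

Lemma ell_o_Phi l : all odd l -> ell_o (Phi l) = n_o l.
Proof.
move=> lo; have [ao bo] := alpha_beta_odd lo.
rewrite PhiE // /ell_o count_odd_fold_ins.
have [t ok tE] := tokens_of_parts bo (beta_part_sorted l).
rewrite -tE (count_odd_B_tokens ok) tE /beta_part size_sort size_filter /n_o.
apply: eq_in_count => i; rewrite mem_undup => /(allP lo).
by case: i.
Qed.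

Lemma weights_gt0 k ts t u : valid_tokens t ->
  perm_eq u (pair_weights k ts ++ token_weights t) -> all (leq 1) u.
Proof.
move=> ok pu; rewrite (perm_all _ pu) all_cat.
rewrite (bressoud_weight_gt0 (bressoud_weight_tokens ok)) andbT.
by apply: sub_all (pair_weights_mod _ _) => x; lia.
Qed.

Lemma size_weights k ts t u : perm_eq u (pair_weights k ts ++ token_weights t) ->
  size u = size t + size ts.
Proof.
by move=> /perm_size ->; rewrite size_cat size_pair_weights size_token_weights addnC.
Qed.

Lemma size_column_counts k ts : all (fun i => i < k) ts ->
  size (foldl incr_nth (nseq k 0) ts) = k.
Proof. by move=> lt; rewrite size_foldl_incr_nth size_nseq. Qed.

Lemma nth_column_counts k ts j :
  nth 0 (foldl incr_nth (nseq k 0) ts) j = count_mem j ts.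
Proof. by rewrite nth_foldl_incr_nth nth_nseq if_same. Qed.

Lemma sumn_column_counts k ts : sumn (foldl incr_nth (nseq k 0) ts) = size ts.
Proof.
rewrite -[RHS]add0n -[X in X + _](mul0n k) -sumn_nseq.
elim: ts (nseq k 0) => [|i ts IH] c /=; first by rewrite addn0.
by rewrite IH sumn_incr_nth addSnnS.
Qed.

(** Each insertion contributes 2: a new pair has difference 2, and new columns widen one difference
    by 2. *)
Lemma alt_sum_Phi l : all odd l -> alt_sum (Phi l) = Posz (size l).
Proof.
move=> lo.
have [t [ts1 [ts2 [u [[ok tE] [tsE _] [nw lt2] [pu su] ->]]]]] := Phi_data lo.
have szu := size_weights pu; rewrite -szu in lt2.
rewrite alt_sum_gam ?size_column_counts ?(weights_gt0 ok pu) //.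
rewrite sumn_column_counts (perm_size (alpha_beta_perm l)) !size_cat -tE.
have -> : size (alpha_part l) = size ts1 + size ts2.
  by rewrite -size_cat -tsE size_map.
rewrite (size_token_parts ok) (permP pu) count_cat szu.
have -> : count (fun v => ~~ odd v) (pair_weights (size t) ts1) = size ts1.
  rewrite -(size_pair_weights (size t) ts1); apply/eqP; rewrite -all_count.
  by apply: sub_all (pair_weights_mod _ _) => x; lia.
congr Posz; move: (size t) (size ts1) (size ts2) (count _ _) => x y z w.
by lia.
Qed.

Lemma filter_weights k ts t u : valid_tokens t ->
  perm_eq u (pair_weights k ts ++ token_weights t) ->
  perm_eq [seq v <- u | v %% 4 == 2] (pair_weights k ts) /\
  perm_eq [seq v <- u | v %% 4 != 2] (token_weights t).
Proof.
move=> ok pu; have mod_pw := pair_weights_mod k ts.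
have mod_tv : all (fun v => v %% 4 != 2) (token_weights t).
  apply: sub_all (bressoud_weight_tokens ok) => v; rewrite /bressoud_weight; lia.
split; apply: perm_trans (perm_filter _ pu) _; rewrite filter_cat.
  rewrite (all_filterP mod_pw) (@eq_in_filter _ _ pred0) ?filter_pred0 ?cats0 //.
  by move=> v /(allP mod_tv) /negPf.
rewrite (all_filterP mod_tv) (@eq_in_filter _ _ pred0) ?filter_pred0 //.
by move=> v /(allP mod_pw) ->.
Qed.

Lemma map_halfK_odd a :
  all odd a -> [seq x.*2.+1 | x <- [seq x./2 | x <- a]] = a.
Proof. by elim: a => [//|x a IH] /= /andP[xo /IH ->]; congr (_ :: _); lia. Qed.

(** The image determines [u] and the column counts. Residues modulo 4 split [u] into the weights of
    [ts1] and of the tokens, and the counts give [ts2]. *)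
Lemma Phi_inj l l' : all odd l -> all odd l' ->
  sorted geq l -> sorted geq l' -> Phi l = Phi l' -> l = l'.
Proof.
move=> lo lo' sl sl'.
have [t [ts1 [ts2 [u [[ok tE] [tsE st] [nw lt2] [pu su] ->]]]]] := Phi_data lo.
have [t' [ts1' [ts2' [u' [[ok' tE'] [tsE' st'] [nw' lt2'] [pu' su'] ->]]]]] :=
  Phi_data lo'.
rewrite -(size_weights pu) in lt2; rewrite -(size_weights pu') in lt2'.
move=> /positives_gam_inj[|||| uE cE].
- by rewrite size_column_counts.
- by rewrite size_column_counts.
- exact: weights_gt0 ok pu.
- exact: weights_gt0 ok' pu'.
subst u'.
have [pw tv] := filter_weights ok pu; have [pw' tv'] := filter_weights ok' pu'.
have ttE : t = t'.
  by apply: token_weights_inj => //; rewrite -(permPl tv).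
subst t'; have [st1 st2] := cat_sorted2 st; have [st1' st2'] := cat_sorted2 st'.
have ts1E : ts1 = ts1'.
  apply: (pair_weights_inj nw nw'); apply: (sorted_eq gtn_trans gtn_anti).
  - exact: pair_weights_sorted.
  - exact: pair_weights_sorted.
  - by rewrite -(permPl pw).
have ts2E : ts2 = ts2'.
  apply: (sorted_eq geq_trans geq_anti) => //; apply: perm_count_mem => j.
  by rewrite -(nth_column_counts (size u)) cE nth_column_counts.
have aE : alpha_part l = alpha_part l'.
  have [ao _] := alpha_beta_odd lo; have [ao' _] := alpha_beta_odd lo'.
  by rewrite -[LHS]map_halfK_odd // -[RHS]map_halfK_odd // tsE tsE' ts1E ts2E.
apply: (sorted_eq geq_trans geq_anti) => //.
by rewrite (permPl (alpha_beta_perm l)) aE -tE tE' perm_sym alpha_beta_perm.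
Qed.

Lemma Phi_sorted l : all odd l -> sorted gtn (Phi l).
Proof.
move=> lo.
have [t [ts1 [ts2 [u [[ok tE] _ [nw lt2] [pu su] ->]]]]] := Phi_data lo.
rewrite -(size_weights pu) in lt2.
apply: (sorted_filter gtn_trans); apply: gam_sorted => //.
  by rewrite size_column_counts.
exact: weights_gt0 ok pu.
Qed.

Lemma Phi_gt0 l : all odd l -> all (leq 1) (Phi l).
Proof.
move=> lo; have [t [ts1 [ts2 [u [_ _ _ _ ->]]]]] := Phi_data lo.
exact: filter_all.
Qed.

Lemma Phi_surj m : sorted gtn m -> all (leq 1) m ->
  exists l, [/\ all odd l, sorted geq l & Phi l = m].
Proof.
move=> sm m0; have [u [c [szc u0 su <-]]] := gam_exists sm m0.
pose os := [seq v <- u | odd v]; pose es := [seq v <- u | ~~ odd v].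
(* Multiples of 4 go to the tokens, residues 2 to the created pairs. *)
pose es0 := [seq v <- es | v %% 4 != 2]; pose es2 := [seq v <- es | v %% 4 == 2].
have ses : sorted gtn es.
  have ev : all (fun v => ~~ odd v) es by apply: filter_all.
  apply: (sub_in_sorted _ ev (sorted_filter wge_trans _ su)) => x y.
  by rewrite /in_mem /= /wge; lia.
have [||||t ok tE] := @tokens_exist os es0.
- apply: (sub_sorted _ (sorted_filter wge_trans _ su)) => x y.
  by rewrite /wge /=; lia.
- exact: filter_all.
- exact: (sorted_filter gtn_trans).
- apply/allP => v; rewrite !mem_filter => /and3P[v2 ev /(allP u0)].
  by lia.
have [||ts1 [nw st1 ts1E le_ts1]] := @pair_weights_exists (size t) es2.
- exact: (sorted_filter gtn_trans).
- exact: filter_all.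
have pu : perm_eq u (pair_weights (size t) ts1 ++ token_weights t).
  apply/permP => p; rewrite ts1E !count_cat (permP tE) count_cat.
  have <- : count p os + count p es = count p u.
    by rewrite -count_cat; apply/permP/permEl/perm_filterC.
  have <- : count p es2 + count p es0 = count p es.
    rewrite -count_cat.
    exact/permP/permEl/(perm_filterC (fun v => v %% 4 == 2)).
  by rewrite addnCA.
have szu := size_weights pu.
pose ts2 := sort geq (flatten [seq nseq (nth 0 c j) j | j <- iota 0 (size u)]).
have cts2 j : count_mem j ts2 = nth 0 c j.
  rewrite (permP (introT permPl (perm_sort _ _))) count_mem_flatten_nseq ?iota_uniq //.
  rewrite mem_iota add0n leq0n /=; case: ltnP => [|le_j]; rewrite ?mul1n //.
  by rewrite nth_default // szc.
have lt2 : all (fun i => i < size u) ts2.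
  apply/allP => i; rewrite -has_pred1 has_count cts2; apply: contraTT.
  by rewrite -leqNgt -eqn0Ngt => le_i; rewrite nth_default // szc.
(* Entries of [ts1] are at least [size u - 1], those of [ts2] at most that. *)
have st : sorted geq (ts1 ++ ts2).
  rewrite (sorted_pairwise geq_trans) pairwise_cat -!(sorted_pairwise geq_trans).
  rewrite st1 (sort_sorted geq_total) !andbT; apply/allrelP => i j.
  move=> /(allP le_ts1) le_i /(allP lt2) /=.
  rewrite szu -(size_pair_weights (size t) ts1) ts1E => lt_j.
  exact: leq_trans lt_j le_i.
pose a := [seq x.*2.+1 | x <- ts1 ++ ts2].
have sa : sorted geq a.
  by rewrite sorted_map; apply: sub_sorted st => x y /=; rewrite ltnS leq_double.
have [aE bE] := alpha_beta_sort sa (token_parts_sorted ok).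
have ao : all odd a by apply/allP => x /mapP[y _ ->]; rewrite /= odd_double.
set l := sort _ _ in aE bE.
exists l; split.
- rewrite (perm_all _ (introT permPl (perm_sort _ _))) !all_cat ao.
  by rewrite token_parts_odd.
- exact: (sort_sorted geq_total).
rewrite PhiE aE // bE.
have -> : [seq x./2 | x <- a] = ts1 ++ ts2.
  by rewrite -map_comp map_id_in // => x _; rewrite /= uphalf_double.
rewrite szu in lt2.
have [u' [pu' su' ->]] := fold_ins_B_tokens ok st1 nw lt2.
have -> : u' = u.
  apply: (sorted_eq wge_trans wge_anti) => //.
  by rewrite (permPl pu') perm_sym.
congr (positives (gam _ _)).
rewrite -szu in lt2.
apply: (@eq_from_nth _ 0); first by rewrite size_column_counts.
by move=> j _; rewrite nth_column_counts cts2.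
Qed.

Lemma alpha_part_uniq l : uniq l -> alpha_part l = [::].
Proof.
move=> ul; apply/nilP; rewrite /nilp -leqn0 leqNgt -has_predT; apply/hasP => -[x].
rewrite -has_pred1 has_count count_mem_alpha_part /mult count_uniq_mem //.
by case: (x \in l).
Qed.

Theorem mainTheorem2 (n : nat) (hn : 0 < n) :
  [/\ (forall l, in_O n l -> in_D n (Phi l)),
      {in in_O n &, injective Phi},
      (forall m, in_D n m -> exists2 l, in_O n l & Phi l = m),
      (forall l, in_O n l -> in_D n l -> Phi l = B l) &
      (forall l, in_O n l ->
         alt_sum (Phi l) = Posz (size l) /\ ell_o (Phi l) = n_o l)].
Proof.
split.
- move=> l /and3P[_ /eqP <- lo]; have := Phi_sorted lo.
  rewrite gtn_sorted_uniq_geq => /andP[uP sP].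
  by apply/and3P; split; rewrite ?sumn_Phi //; apply/andP; split; rewrite ?Phi_gt0.
- move=> l l' /and3P[/andP[sl _] _ lo] /and3P[/andP[sl' _] _ lo'].
  exact: Phi_inj.
- move=> m /and3P[/andP[sm m0] sumE um].
  have [|l [lo sl lE]] := @Phi_surj m _ m0; first by rewrite gtn_sorted_uniq_geq um.
  exists l => //; apply/and3P; split=> //; last by rewrite -sumn_Phi // lE.
  by apply/andP; split=> //; apply: sub_all lo; case.
- move=> l /and3P[/andP[sl _] _ lo] /and3P[_ _ ul].
  (* Distinct parts leave nothing to insert. *)
  rewrite PhiE alpha_part_uniq //; congr B.
  apply: (sorted_eq geq_trans geq_anti) => //.
    by have := beta_part_sorted l; rewrite gtn_sorted_uniq_geq => /andP[].
  by have := alpha_beta_perm l; rewrite alpha_part_uniq //= cats0 perm_sym.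
by move=> l /and3P[_ _ lo]; rewrite alt_sum_Phi // ell_o_Phi.
Qed.
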